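(* Let $K$ be an (oriented) virtual knot with diagram $D$. Then $V_D(t) = \Phi(D)(t, t^{-1})$, where $V_D(t)$ is the Laurent polynomial defined from the Gauss diagram of $D$ in the context, and $\Phi(D)(u,v)$ is the Laurent polynomial determined by $\Delta'_0(D)(u,v) + W_K(u) = (1-uv)\,\Phi(D)(u,v)$, with $\Delta_0(D)(u,v)=(1-uv)\,\Delta_0'(D)(u,v)$.
   Context: Virtual knots are equivalence classes of oriented virtual knot diagrams modulo the classical and virtual Reidemeister moves. The Gauss diagram of $D$ is an oriented circle with one chord per classical crossing $c$, directed from the over-crossing point to the under-crossing point and labelled with the crossing sign $\varepsilon(c)=\pm1$. The over-crossing endpoint of $c$ is labelled with the sign $-\varepsilon(c)$ and the under-crossing endpoint with $\varepsilon(c)$. For a chord $c$ from $P$ (over) to $Q$ (under), let $\alpha$ be the open arc of the circle from $P$ to $Q$ and $\beta$ the open arc from $Q$ to $P$ (both following the orientation). $Ind(c)$ is the sum of the signs of all endpoints on $\alpha$; $LO(c)$ is the sum of the signs of the over-crossing endpoints on $\beta$. Writhe polynomial: $Wr(D)=\sum_c \varepsilon(c)$; $w_n(D)=\sum_{Ind(c)=n}\varepsilon(c)$; $w_n(K)=w_n(D)$ for $n\ne0$, $w_0(K)=w_0(D)-Wr(D)$; $W_K(t)=\sum_{n\in\mathbb{Z}} w_n(K)t^n$ (an invariant of $K$). Let $S_1$ (configuration A) be the set of unordered pairs $\{c_1,c_2\}$ of chords whose endpoints occur around the circle in cyclic order $O_1U_1O_2U_2$, and $S_2$ (configuration B) the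 set of unordered pairs whose endpoints occur in cyclic order $O_1U_2O_2U_1$, where $O_i,U_i$ are the over- and under-crossing endpoints of $c_i$. Define $$V_D(t) = \frac{Wr(D)(Wr(D)+1)}{2} + \sum_c \varepsilon(c)t^{Ind(c)}\left[LO(c) - \frac{1+\varepsilon(c)}{2}\right] + \sum_{\{c_i,c_j\}\in S_1}\varepsilon(c_i)\varepsilon(c_j)t^{Ind(c_i)+Ind(c_j)} - \sum_{\{c_i,c_j\}\in S_2}\varepsilon(c_i)\varepsilon(c_j)t^{Ind(c_i)+Ind(c_j)}.$$ Alexander polynomial of a diagram: let $D$ have $n\ge 1$ classical crossings $c_1,\dots,c_n$. An arc of $D$ runs from one classical crossing passage to the next one (virtual crossings are ignored), so there are $2n$ arcs $a_1,\dots,a_{2n}$, labelled so that the arcs coming into $c_i$ are $a_{2i-1}$ and $a_{2i}$: if $c_i$ is positive, $a_{2i-1}$ is the incoming under-strand and $a_{2i}$ the incoming over-strand; if $c_i$ is negative, $a_{2i-1}$ is the incoming over-strand and $a_{2i}$ the incoming under-strand. Let $M$ be the block diagonal matrix with blocks $M_1,\dots,M_n$, where $M_i=\begin{pmatrix} u^{-1} & 1-(uv)^{-1}\\ 0& v^{-1}\end{pmatrix}$ if $c_i$ is positive and $M_i=\begin{pmatrix} v&0\\ 1-uv& u\end{pmatrix}$ if $c_i$ is negative. Let $\pi$ be the $2n$-cycle sending each arc to the next arc along the oriented knot, and $P_{ij}=1$ if $\pi(a_i)=a_j$, $0$ otherwise. Then $\Delta_0(D)(u,v)=\det(M-P)$,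 with no normalization. (For a diagram without classical crossings, $\Delta_0(D)=0$.) It is known that $1-uv$ divides $\Delta_0(D)$; and $W_K(u)=-\Delta_0'(D)(u,u^{-1})$, so that $1-uv$ divides $\Delta_0'(D)(u,v)+W_K(u)$. *)

(* Defs.v *)
(* MathComp world, with mathcomp-finmap and multinomials (monalg). *)
From HB Require Import structures.
From mathcomp Require Import all_boot all_order all_algebra.
From mathcomp Require Import finmap.
From mathcomp.multinomials Require Import monalg.

Set Implicit Arguments.
Unset Strict Implicit.
Unset Printing Implicit Defensive.

Import GRing.Theory.
Local Open Scope ring_scope.

(* The group ring Z[G] of a (multiplicatively written) abelian group G.
   [monalg] has the additive group of finitely supported functions G -> Z, but
   its product excludes exponent monoids with nontrivial units, hence the
   wrapper. Z[int] is Z[t,t^-1] and Z[int * int] is Z[u,u^-1,v,v^-1]. *)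
Definition laurent (G : zmodType) : Type := {malg int[G]}.

HB.instance Definition _ (G : zmodType) := 
  GRing.Zmodule.copy (laurent G) {malg int[G]}.

Definition monomial (G : zmodType) (k : G) : laurent G := mkmalgU k 1.

Definition laurent_mul (G : zmodType) (f g : laurent G) : laurent G :=
  \sum_(k <- msupp f) \sum_(l <- msupp g) mkmalgU (k + l) (f@_k * g@_l).

Section LaurentRing.
Variable G : zmodType.
Implicit Types (f g h : laurent G) (k l : G).

Local Notation mul := (@laurent_mul G).

Lemma laurent_mulEw (d1 d2 : {fset G}) f g :
  (msupp f `<=` d1)%fset -> (msupp g `<=` d2)%fset ->
  mul f g = \sum_(k <- d1) \sum_(l <- d2) mkmalgU (k + l) (f@_k * g@_l).
Proof.
move=> le1 le2; rewrite /laurent_mul (big_fset_incl _ le1) /=.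
  apply/eq_bigr=> k _; apply/big_fset_incl => // l _ /mcoeff_outdom ->.
  by rewrite mulr0 monalgU0.
move=> k _ /mcoeff_outdom fk.
by rewrite big1 => // l _; rewrite fk mul0r monalgU0.
Qed.

Lemma laurent_mulC : commutative mul.
Proof.
move=> f g; rewrite /laurent_mul exchange_big /=.
by apply/eq_bigr=> l _; apply/eq_bigr=> k _; rewrite addrC mulrC.
Qed.

Lemma laurent_mulDl : left_distributive mul +%R.
Proof.
move=> f g h.
rewrite [in RHS](laurent_mulEw (fsubsetUl _ (msupp g)) (fsubset_refl _)).
rewrite [in RHS](laurent_mulEw (fsubsetUr (msupp f) _) (fsubset_refl _)).
rewrite (laurent_mulEw (msuppD_le _ _) (fsubset_refl _)).
rewrite -big_split /=; apply/eq_bigr=> k _.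
rewrite -big_split /=; apply/eq_bigr=> l _.
by rewrite mcoeffD mulrDl monalgUD.
Qed.

Lemma laurent_mul0r f : mul 0 f = 0.
Proof. by rewrite /laurent_mul msupp0 big_seq_fset0. Qed.

Lemma laurent_mulr0 f : mul f 0 = 0.
Proof. by rewrite laurent_mulC laurent_mul0r. Qed.

Lemma laurent_mulUU k l (a b : int) :
  mul (mkmalgU k a) (mkmalgU l b) = mkmalgU (k + l) (a * b).
Proof.
by rewrite (laurent_mulEw msuppU_le msuppU_le) !big_seq_fset1 !mcoeffUU.
Qed.

Lemma laurent_mulDr : right_distributive mul +%R.
Proof.
by move=> f g h; rewrite ![mul f _]laurent_mulC laurent_mulDl.
Qed.

Lemma laurent_ind (P : laurent G -> Prop) :
  P 0 -> (forall f g, P f -> P g -> P (f + g)) ->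
  (forall k (a : int), P (mkmalgU k a)) -> forall f, P f.
Proof.
by move=> P0 PD PU f; rewrite (monalgE f : f = _ :> laurent G); apply: big_ind.
Qed.

Lemma laurent_mulA : associative mul.
Proof.
move=> f g h; elim/laurent_ind: f => [|f1 f2 IH1 IH2|k a].
- by rewrite !laurent_mul0r.
- by rewrite !laurent_mulDl IH1 IH2.
elim/laurent_ind: g => [|g1 g2 IH1 IH2|l b].
- by rewrite laurent_mulr0 !laurent_mul0r laurent_mulr0.
- by rewrite !(laurent_mulDl, laurent_mulDr) IH1 IH2.
elim/laurent_ind: h => [|h1 h2 IH1 IH2|m c].
- by rewrite !laurent_mulr0.
- by rewrite !laurent_mulDr IH1 IH2.
by rewrite !laurent_mulUU addrA mulrA.
Qed.

Lemma laurent_mul1 : left_id (monomial 0) mul.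
Proof.
elim/laurent_ind => [|f g IHf IHg|k a].
- by rewrite laurent_mulr0.
- by rewrite laurent_mulDr IHf IHg.
by rewrite laurent_mulUU add0r mul1r.
Qed.

Lemma laurent_1neq0 : monomial 0 != 0 :> laurent G.
Proof. by rewrite /monomial monalgU_eq0 oner_eq0. Qed.

End LaurentRing.

HB.instance Definition _ (G : zmodType) :=
  GRing.Zmodule_isComNzRing.Build (laurent G) (@laurent_mulA G)
    (@laurent_mulC G) (@laurent_mul1 G) (@laurent_mulDl G) (@laurent_1neq0 G).

Notation laurent2 := (laurent (int * int)%type).

Definition t_ (k : int) : laurent int := monomial k.
Definition uv_ (k l : int) : laurent2 := monomial (k, l).

Definition in_u (f : laurent int) : laurent2 :=
  mmap intr (fun k => uv_ k 0) f.

Definition eval_t_tinv (f : laurent2) : laurent int :=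
  mmap intr (fun k => t_ k.1 * t_ (- k.2)) f.

(* (c, true) is the over-crossing endpoint of chord c, (c, false) the
   under-crossing one. *)
Notation endpoint n := ('I_n * bool)%type.

(* An injection between sets of size 2n is a bijection: the 2n endpoints are
   numbered 0, ..., 2n-1 in the order in which they are met when following the
   oriented circle from some base point. *)
Record gauss_diagram (n : nat) := GaussDiagram {
  position : endpoint n -> 'I_(n.*2);
  position_inj : injective position;
  positive : 'I_n -> bool
}.

Section GaussDiagram.
Variables (n : nat) (D : gauss_diagram n).
Implicit Types (c i j : 'I_n) (e : endpoint n).

Definition over c : endpoint n := (c, true).
Definition under c : endpoint n := (c, false).

Definition eps c : int := if positive D c then 1 else -1.

Definition esign e : int := if e.2 then - eps e.1 else eps e.1.

(* The endpoints in s are pairwise distinct and met in this cyclic order. *)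
Definition cyclically (s : seq (endpoint n)) : bool :=
  has (fun k => sorted ltn (rot k [seq (position D e : nat) | e <- s]))
      (iota 0 (size s)).

Definition Ind c : int :=
  \sum_(e : endpoint n | cyclically [:: over c; e; under c]) esign e.

Definition LO c : int :=
  \sum_(d < n | cyclically [:: under c; over d; over c]) esign (over d).

Definition Wr : int := \sum_(c < n) eps c.

Definition writhe_coef (m : int) : int :=
  \sum_(c < n | Ind c == m) eps c - (if m == 0 then Wr else 0).

(* All other coefficients vanish. *)
Definition writhe_poly : laurent int :=
  \sum_(m <- undup (0 :: codom Ind)) (writhe_coef m)%:~R * t_ m.

Definition configA i j : bool :=
  cyclically [:: over i; under i; over j; under j].
Definition configB i j : bool :=
  cyclically [:: over i; under j; over j; under i].

(* Both divisions by 2 are exact. *)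
Definition V_poly : laurent int :=
  ((Wr * (Wr + 1)) %/ 2)%Z%:~R
  + \sum_(c < n) (eps c * (LO c - ((1 + eps c) %/ 2)%Z))%:~R * t_ (Ind c)
  + \sum_(i < n) \sum_(j < n | (i < j)%N && configA i j)
      (eps i * eps j)%:~R * t_ (Ind i + Ind j)
  - \sum_(i < n) \sum_(j < n | (i < j)%N && configB i j)
      (eps i * eps j)%:~R * t_ (Ind i + Ind j).

(* An arc is identified with the endpoint (crossing passage) it leads into;
   [in_arc i 0] and [in_arc i 1] are the first and the second arc coming into i. *)
Definition in_arc i (a : 'I_2) : endpoint n :=
  (i, if positive D i then a == 1 else a == 0).

Definition arc_next e e' : bool := position D e' == ordS (position D e).

Definition mx2 (R : Type) (x00 x01 x10 x11 : R) : 'M[R]_2 :=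
  \matrix_(a, b) (if a == 0 then if b == 0 then x00 else x01
                  else if b == 0 then x10 else x11).

Definition crossing_block i : 'M[laurent2]_2 :=
  if positive D i
  then mx2 (uv_ (-1) 0) (1 - uv_ (-1) (-1)) 0             (uv_ 0 (-1))
  else mx2 (uv_ 0 1)    0                   (1 - uv_ 1 1) (uv_ 1 0).

Definition crossing_mx : 'M[laurent2]_(\sum_(i < n) 2) :=
  \mxdiag_(i < n) crossing_block i.

Definition arc_mx : 'M[laurent2]_(\sum_(i < n) 2) :=
  \mxblock_(i < n, j < n) \matrix_(a < 2, b < 2) (arc_next (in_arc i a) (in_arc j b))%:R.

Definition Delta0 : laurent2 :=
  if n == 0%N then 0 else \det (crossing_mx - arc_mx).

End GaussDiagram.

(* Main.v *)
Require Import Defs.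
From HB Require Import structures.
From mathcomp Require Import all_boot all_order all_algebra.
From mathcomp Require Import perm zify ring finmap.
From mathcomp.multinomials Require Import monalg.

Set Implicit Arguments.
Unset Strict Implicit.
Unset Printing Implicit Defensive.

Import GRing.Theory.
Local Open Scope ring_scope.

Local Notation over := Defs.over.

(** The rows and columns of the matrix M - P are indexed by arcs, that is, by
the endpoints of the chords. Its entries are
  w_e [e' = e] - [e' = next e] + [e = U_c] (1 - q^(-eps c)) [e' = O_c],
where q = uv and w_e is u^(-eps c) at the under-endpoint U_c of a chord c and
v^(-eps c) at its over-endpoint O_c. The first two terms give a weighted
cyclic matrix A. Each third term changes the single row U_c, so expanding the
determinant along these rows ([fdet_expand]) gives
  Delta0 = sum over sets S of chords of
             prod_(c in S) (1 - q^(-eps c)) * det A_S,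
where the rows U_c of A_S, for c in S, are replaced by the unit vectors
e_(O_c). Every factor 1 - q^(-eps c) is divisible by h = 1 - q, so only the
sets S with at most two elements matter modulo h^3.

A permutation that contributes to det A_S either fixes an endpoint or moves it
to the next one, except that it must send U_c to O_c for c in S. When S has
one or two elements, there is at most one such permutation:
- det A = q^(-Wr) - 1, from the identity and the full cycle
  ([redirect_det0]);
- for S = {c} the arc from O_c to U_c closes up, and the weights of the
  remaining endpoints multiply to u^(Ind c) q^(LO c) ([redirect_det1]);
- for S = {i, j} the determinant is, up to a power of q, u^(Ind i + Ind j) in
  configuration A (two cycles), its opposite in configuration B (the two arcs
  overlap and join into one cycle), and 0 otherwise ([redirect_det2]).

As q^(-k) = 1 + k h + k(k+1)/2 h^2 modulo h^3 ([eqmod_cube_character]), the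
coefficient of h is Wr - sum_c eps(c) u^(Ind c) = - W_K(u), and the
coefficient of h^2 specializes at v = u^(-1) to V_D ([alexander_det_eqmod_cube]
and [phi_second_coef]). The quotients Delta0' and Phi exist because of this
expansion, and are unique because h is not a zero divisor ([one_sub_uv_regular]). *)

(** * Determinants over finite index types *)

Lemma modn_succ N k : (k < N)%N -> (k.+1 %% N = if k.+1 == N then 0 else k.+1)%N.
Proof. by move=> kN; case: eqP => [->|?]; rewrite ?modnn // modn_small //; lia. Qed.

Section Determinants.
Variable R : comNzRingType.

Lemma det_bij M N (f : 'I_M -> 'I_N) (F : 'I_N -> 'I_N -> R) :
  bijective f ->
  \det (\matrix_(x, y) F (f x) (f y)) = \det (\matrix_(x, y) F x y).
Proof.
move=> f_bij; have eMN : M = N by rewrite -(card_ord M) (bij_eq_card f_bij) card_ord.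
case: N / eMN in f f_bij F *.
have [s sE] : exists s : 'S_M, forall x, s x = f x.
  by exists (perm (bij_inj f_bij)) => x; rewrite permE.
have -> : \matrix_(x, y) F (f x) (f y) = row_perm s (col_perm s (\matrix_(x, y) F x y)).
  by apply/matrixP => x y; rewrite !mxE !sE.
rewrite row_permE col_permE !det_mulmx !det_perm odd_permV mulrCA -signr_addb addbb.
by rewrite mulr1.
Qed.

(** The determinant of a matrix indexed by an arbitrary finite type, so that rows
and columns can be named by endpoints and numbered from any base point. *)
Definition fdet (T : finType) (F : T -> T -> R) : R :=
  \det (\matrix_(x, y < #|T|) F (enum_val x) (enum_val y)).

Lemma fdet_bij (T : finType) N (f : 'I_N -> T) (F : T -> T -> R) :
  bijective f -> fdet F = \det (\matrix_(x, y) F (f x) (f y)).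
Proof.
move=> f_bij; have rf_bij := bij_comp (enum_rank_bij T) f_bij.
rewrite -[LHS](det_bij (fun x y => F (enum_val x) (enum_val y)) rf_bij).
by congr (\det _); apply/matrixP => x y; rewrite !mxE /= !enum_rankK.
Qed.

Lemma eq_fdet (T : finType) (F G : T -> T -> R) : F =2 G -> fdet F = fdet G.
Proof. by move=> eFG; congr (\det _); apply/matrixP => x y; rewrite !mxE eFG. Qed.

(** Multilinearity in the rows [(c, false)], which are the only ones that carry a
perturbation. Grouping the Leibniz product by [c] makes the subsets of [C]
index the expansion. *)
Lemma fdet_expand (C : finType) (A B : C * bool -> C * bool -> R) (w : C -> R) :
  fdet (fun e e' => A e e' + (if e.2 then 0 else w e.1 * B e e')) =
  \sum_(S : {set C}) (\prod_(c in S) w c) *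
     fdet (fun e e' => if ~~ e.2 && (e.1 \in S) then B e e' else A e e').
Proof.
under eq_bigr => S _ do rewrite /fdet /determinant mulr_sumr.
rewrite exchange_big /=; apply: eq_bigr => s _.
pose ev (e : C * bool) := enum_val (s (enum_rank e)).
have prodE (G : C * bool -> C * bool -> R) :
    \prod_i (\matrix_(x, y) G (enum_val x) (enum_val y)) i (s i) =
    \prod_c (G (c, true) (ev (c, true)) * G (c, false) (ev (c, false))).
  transitivity (\prod_(e : C * bool) G e (ev e)).
    rewrite (reindex _ (onW_bij _ (enum_val_bij (C * bool)%type))) /=.
    by apply: eq_bigr => x _; rewrite mxE /ev enum_valK.
  transitivity (\prod_c \prod_b G (c, b) (ev (c, b))).
    by rewrite pair_bigA; apply: eq_bigr => -[].
  by apply: eq_bigr => c _; rewrite big_bool.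
rewrite (prodE (fun e e' => A e e' + (if e.2 then 0 else w e.1 * B e e'))).
under eq_bigr => c _ do rewrite /= addr0 mulrDr addrC.
rewrite bigA_distr mulr_sumr; apply: eq_bigr => S _.
rewrite mulrCA (prodE (fun e e' => if ~~ e.2 && (e.1 \in S) then B e e' else A e e')).
congr (_ * _).
rewrite [X in _ = X * _]big_mkcond -big_split; apply: eq_bigr => c _ /=.
by case: ifP => _; rewrite ?mul1r //; ring.
Qed.

(** Only [s0] contributes to the Leibniz formula. If [s] does, then
[t = s0^-1 \o s] increases [r] at every point that it moves; as [t] is a
permutation, the sum of [r] is unchanged, so [t] moves nothing. *)
Lemma det_trig_rank N (F : 'M[R]_N) (s0 : 'S_N) (r : 'I_N -> nat) :
  (forall x y, x != y -> (r y <= r x)%N -> F x (s0 y) = 0) ->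
  \det F = (-1) ^+ s0 * \prod_x F x (s0 x).
Proof.
move=> F0; rewrite /determinant (bigD1 s0) //= [X in _ + X]big1 ?addr0 // => s ne_s.
pose t x := (s0^-1)%g (s x).
have tE x : s x = s0 (t x) by rewrite /t permKV.
have t_inj : injective t by move=> x y /perm_inj/perm_inj.
case: (pickP (fun x => (x != t x) && (r (t x) <= r x)%N)) => [x /andP[ne le]|noP].
  by rewrite (bigD1 x) //= tE F0 // mul0r mulr0.
have le_r x : (r x <= r (t x) ?= iff (x == t x))%N.
  split; first by case: eqVneq (noP x) => [<-|_ /=]; lia.
  by case: eqVneq (noP x) => [<-|_ /=]; [rewrite eqxx | lia].
have [_] := leqif_sum (fun x (_ : true) => le_r x).
have eS : (\sum_x r x = \sum_x r (t x))%N by exact: (reindex_inj t_inj).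
rewrite -eS eqxx => /esym/forallP all_t; case/eqP: ne_s.
by apply/permP => x; rewrite tE -(eqP (all_t x)).
Qed.

(** Failure of the marriage condition: no permutation can send the rows in [X]
into the columns in [Y]. *)
Lemma det0_hall N (F : 'M[R]_N) (X Y : {set 'I_N}) :
  (#|Y| < #|X|)%N -> (forall x y, x \in X -> y \notin Y -> F x y = 0) ->
  \det F = 0.
Proof.
move=> ltYX F0; rewrite /determinant [LHS]big1 // => s _.
case: (pickP (fun x => (x \in X) && (s x \notin Y))) => [x /andP[Xx nYx]|noP].
  by rewrite (bigD1 x) //= F0 // mul0r mulr0.
suff : (#|X| <= #|Y|)%N by lia.
rewrite -(card_imset (mem X) (@perm_inj _ s)); apply/subset_leq_card/subsetP.
by move=> _ /imsetP[x Xx ->]; move: (noP x); rewrite Xx => /negbFE.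
Qed.

(** The cycle [a -> a.+1 -> ... -> b -> a]. Its parity is recorded as a cardinal
because each point of [a, b[ will also contribute an entry [-1] of the cyclic
matrix, and the two signs cancel. *)
Lemma interval_cycle N (a b : 'I_N) : (a <= b)%N ->
  exists2 s : 'S_N, odd_perm s = odd #|[pred x : 'I_N | a <= x < b]%N| &
    forall x, val (s x) =
      if (a <= x < b)%N then x.+1 else if x == b then a : nat else x.
Proof.
have [d] := ubnP (b - a); elim: d b => // d IH b ltd.
rewrite leq_eqVlt => /orP[/eqP/val_inj <-|lt_ab].
  exists 1%g; first by rewrite odd_perm1 eq_card0 // => x; rewrite !inE; lia.
  by move=> x; rewrite perm1; case: ifP => [|_]; [lia | case: eqVneq => [->|]].
have b1P : (b.-1 < N)%N by have := ltn_ord b; lia.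
pose b1 := Ordinal b1P.
have [||s odds sE] := IH b1; [rewrite /=; lia | rewrite /=; lia |].
have ne_ab : a != b by rewrite -val_eqE /=; lia.
exists (s * tperm a b)%g.
  have b1_in : b1 \in [pred x : 'I_N | a <= x < b]%N by rewrite inE /=; lia.
  rewrite odd_permM odds odd_tperm ne_ab addbT [in RHS](cardD1 b1) b1_in.
  rewrite add1n /=; congr (~~ odd _); apply: eq_card => x.
  by rewrite !inE -val_eqE /=; lia.
move=> x; rewrite permM.
have := sE x; rewrite -!val_eqE /=; case: tpermP => [-> | -> | /eqP + /eqP +].
- by repeat case: ifP; lia.
- by repeat case: ifP; lia.
by rewrite -!val_eqE /=; repeat case: ifP; lia.
Qed.

(** * Cyclic matrices with redirected rows *)

(** The matrix of a weighted cycle, in which the rows satisfying [Z] are replaced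
by the unit vectors designated by [tau]. *)
Definition redirect_mx N (m : 'I_N -> R) (Z : pred 'I_N) (tau : 'I_N -> 'I_N) :=
  \matrix_(x, y) if Z x then (y == tau x)%:R else
     m x *+ (y == x) - (y == ordS x)%:R.

(** [W] is a union of cycles of [s0] that contains every point moved by [s0], and
each cycle runs forward by steps of one except at the points of [Z]. Outside
[Z], row [x] meets only the columns [x] and [ordS x]. Hence the matrix is
triangular along [s0] once [Z] is given the highest rank, the rest of [W] is
ranked by decreasing position and the complement of [W] by increasing position.
The last hypothesis makes the latter work across the base point: when [ordS]
wraps around, it must not lead from outside [W] to outside [W]. *)
Lemma det_redirect N (m : 'I_N -> R) (Z W : pred 'I_N) tau (s0 : 'S_N) :
  (1 < N)%N -> subpred Z W ->
  (forall x, Z x -> s0 x = tau x) ->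
  (forall x, W x -> ~~ Z x -> val (s0 x) = x.+1) ->
  (forall x, ~~ W x -> s0 x = x) ->
  (forall x, ~~ W x -> ~~ W (ordS x) -> x.+1 < N)%N ->
  \det (redirect_mx m Z tau) =
  (-1) ^+ s0 * (-1) ^+ #|[pred x | W x && ~~ Z x]| * \prod_(x | ~~ W x) m x.
Proof.
move=> N1 sZW s0Z s0W s0C wrapP.
have ordSE (x : 'I_N) : val (ordS x) = if x.+1 == N then 0%N else x.+1.
  exact: modn_succ.
have s0WS x : W x -> ~~ Z x -> s0 x = ordS x.
  move=> Wx Zx; apply: val_inj; rewrite s0W // ordSE.
  by have := ltn_ord (s0 x); rewrite s0W //; case: eqP; lia.
rewrite (@det_trig_rank _ _ s0
   (fun x => if Z x then N.*2 else if W x then (N - x)%N else x)); last first.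
  move=> x y ne_xy; rewrite mxE; have [Zx|Zx] := boolP (Z x).
    by rewrite -s0Z // (inj_eq perm_inj) eq_sym (negPf ne_xy).
  have [Zy|Zy] := boolP (Z y); first by have := ltn_ord x; case: ifP; lia.
  have [Wx|Wx] := boolP (W x).
    have -> : (s0 y == ordS x) = false.
      by rewrite -s0WS // (inj_eq perm_inj) eq_sym (negPf ne_xy).
    case: eqP => [s0y le_r|_ _]; last by rewrite subr0.
    have [Wy|Wy] := boolP (W y); last by rewrite -s0y s0C // in Wx; rewrite Wx in Wy.
    move: le_r; rewrite Wy -s0y s0W //.
    by have := ltn_ord y; have := ltn_ord (s0 y); rewrite s0W //; lia.
  have -> : (s0 y == x) = false.
    by rewrite -{1}(s0C x) // (inj_eq perm_inj) eq_sym (negPf ne_xy).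
  case: eqP => [s0y le_r|_ _]; last by rewrite subr0.
  have [Wy|Wy] := boolP (W y).
    have := s0WS _ Wy Zy; rewrite s0y => eS.
    by have /(bij_inj (Bijective (@ordSK N) (@ord_predK N))) exy := eS; rewrite exy eqxx in ne_xy.
  move: le_r; rewrite (negPf Wy) -(s0C y) // s0y ordSE.
  have := wrapP x Wx; rewrite -s0y s0C // => /(_ Wy).
  by case: eqP; lia.
rewrite -mulrA; congr (_ * _).
rewrite (bigID W) /=; congr (_ * _); last first.
  apply: eq_bigr => x Wx; rewrite mxE s0C // eqxx mulr1n.
  have -> : Z x = false by apply: contraNF Wx; apply: sZW.
  suff -> : (x == ordS x) = false by rewrite subr0.
  by rewrite -val_eqE ordSE; apply/eqP => /=; case: (_ =P N) => ? ?; lia.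
rewrite (bigID Z) /= [X in X * _]big1 ?mul1r; last first.
  by move=> x /andP[_ Zx]; rewrite mxE Zx s0Z // eqxx.
rewrite -prodr_const; apply: eq_bigr => x /andP[Wx Zx].
rewrite mxE (negPf Zx) -s0WS // eqxx -val_eqE /= s0W //.
have -> : (x.+1 == x) = false by apply/eqP; lia.
by rewrite mulr0n add0r.
Qed.

(** Splitting the last row into its diagonal entry and its [-1] reduces the
unredirected matrix to two redirected ones, whose permutations are the
identity and the full cycle. *)
Lemma det_redirect0 N (m : 'I_N -> R) tau : (1 < N)%N ->
  \det (redirect_mx m pred0 tau) = \prod_x m x - 1.
Proof.
move=> N1; have N0 : (0 < N)%N by lia.
have lP : (N.-1 < N)%N by lia.
pose z := Ordinal N0; pose l := Ordinal lP.
have ordSl : ordS l = z by apply: val_inj; rewrite /= prednK // modnn.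
have row'E t : row' l (redirect_mx m (pred1 l) t) = row' l (redirect_mx m pred0 tau).
  by apply/matrixP => x y; rewrite !mxE /= eq_sym (negPf (neq_lift _ _)).
rewrite (@determinant_multilinear _ _ _ (redirect_mx m (pred1 l) id)
   (redirect_mx m (pred1 l) (fun=> z)) l (m l) (-1)) ?row'E //; last first.
  apply/rowP => y; rewrite !mxE /= eqxx ordSl mulN1r.
  by rewrite mulr_natr.
rewrite (@det_redirect _ _ _ (pred1 l) _ 1%g) //; first last.
- by move=> x; rewrite !inE -val_eqE /= => nx _; have := ltn_ord x; lia.
- by move=> x _; rewrite perm1.
- by move=> x; rewrite !inE => ->.
- by move=> x; rewrite !inE perm1.
have [//|s odds sE] := @interval_cycle _ z l.
rewrite (@det_redirect _ _ _ predT _ s) //; first last.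
- move=> x _; rewrite inE -val_eqE /= => nl; rewrite sE.
  by rewrite ifT //= ; have := ltn_ord x; lia.
- move=> x; rewrite inE => /eqP ->; apply: val_inj; rewrite sE eqxx /=.
  by rewrite ltnn.
have -> : #|[pred x | predT x && (x != l)]| = #|[pred x : 'I_N | z <= x < l]%N|.
  by apply: eq_card => x; rewrite !inE -val_eqE /=; have := ltn_ord x; lia.
rewrite odd_perm1 expr0 mul1r eq_card0; last by move=> x; rewrite !inE andbN.
rewrite odds signr_odd -expr2 sqrr_sign expr0 !mul1r mulN1r.
rewrite [X in _ - X]big_pred0 //.
by rewrite [in RHS](bigD1 l).
Qed.

End Determinants.

(** * Cyclic order and change of base point *)

Definition cyc3 (a b c : nat) := [|| (a < b < c)%N, (b < c < a)%N | (c < a < b)%N].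

(** The position [x] counted from the new base point [s] on a circle of [N]
points. *)
Definition shift (N s x : nat) : nat := (if x < s then x + N - s else x - s)%N.

Lemma cyc3_shift N s x y z : (s < N)%N -> (x < N)%N -> (y < N)%N -> (z < N)%N ->
  cyc3 (shift N s x) (shift N s y) (shift N s z) = cyc3 x y z.
Proof.
move=> sN xN yN zN.
have lt_f u v : (u < N)%N -> (v < N)%N ->
  (shift N s u < shift N s v)%N = (if (u < s)%N == (v < s)%N then u < v else v < s)%N.
  by move=> uN vN; rewrite /shift; case: (ltnP u s) => us; case: (ltnP v s) => vs /=; lia.
rewrite /cyc3 !lt_f //.
by case: (ltnP x s) => ?; case: (ltnP y s) => ?; case: (ltnP z s) => ? /=; lia.
Qed.

Lemma shift_succ N s x y : (s < N)%N -> (x < N)%N -> (y < N)%N ->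
  (shift N s y == (shift N s x).+1 %% N)%N = (y == x.+1 %% N)%N.
Proof.
move=> sN xN yN.
have fN k : (k < N)%N -> (shift N s k < N)%N by rewrite /shift; case: ifP; lia.
rewrite !modn_succ ?fN // /shift.
by case: (ltnP x s) => ?; case: (ltnP y s) => ?; do 2 case: (_ =P N) => ?; lia.
Qed.

Section Positions.
Variables (n : nat) (D : gauss_diagram n).
Implicit Types (c : 'I_n) (e : endpoint n).

Lemma position_eq e e' : (position D e == position D e' :> nat) = (e == e').
Proof. by rewrite val_eqE (inj_eq (@position_inj _ D)). Qed.

Lemma over_under c c' : (over c == under c') = false.
Proof. by rewrite xpair_eqE andbF. Qed.

Lemma position_bij : bijective (position D).
Proof.
apply: inj_card_bij; first exact: position_inj.
by rewrite card_prod card_bool !card_ord muln2.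
Qed.

Lemma cyclically3E e1 e2 e3 (p := fun e => position D e : nat) :
  cyclically D [:: e1; e2; e3] = cyc3 (p e1) (p e2) (p e3).
Proof. by rewrite /cyclically /= !andbT orbF. Qed.

Lemma cyclically4E e1 e2 e3 e4 (p := fun e => position D e : nat) :
  cyclically D [:: e1; e2; e3; e4] =
  cyc3 (p e1) (p e2) (p e3) && cyc3 (p e1) (p e3) (p e4).
Proof.
rewrite /cyclically /cyc3 /= !andbT orbF -!/(p _).
case: (ltnP (p e1) (p e2)) => ?; case: (ltnP (p e2) (p e3)) => ?;
case: (ltnP (p e3) (p e4)) => ?; case: (ltnP (p e4) (p e1)) => ? /=; lia.
Qed.

(** The arc [alpha] of the chord, with its endpoints. As these have opposite
signs, closing the arc does not change its sum of signs, while the points that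
a contributing permutation moves form a union or an intersection of closed
arcs. *)
Definition closed_arc c e : bool :=
  [|| e == over c, e == under c | cyclically D [:: over c; e; under c]].

Lemma closed_arcE c e
  (o := position D (over c) : nat) (u := position D (under c) : nat)
  (p := position D e : nat) :
  closed_arc c e = if (o < u)%N then (o <= p <= u)%N else (p <= u)%N || (o <= p)%N.
Proof.
have ne_ou : (o == u) = false by rewrite position_eq over_under.
rewrite /closed_arc cyclically3E /cyc3 -!position_eq -/o -/u -/p.
by case: ifP; lia.
Qed.

Lemma sum_esign : \sum_e esign D e = 0.
Proof.
transitivity (\sum_c \sum_b esign D (c, b)).
  by rewrite pair_bigA; apply: eq_bigr => -[].
by rewrite big1 // => c _; rewrite big_bool /esign /= addNr.
Qed.

Lemma sum_esignC (P : pred (endpoint n)) :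
  \sum_(e | ~~ P e) esign D e = - \sum_(e | P e) esign D e.
Proof.
by apply/eqP; rewrite -addr_eq0 addrC; have := sum_esign; rewrite (bigID P) /= => ->.
Qed.

Lemma Ind_closed_arc c : Ind D c = \sum_(e | closed_arc c e) esign D e.
Proof.
have ou : over c != under c by rewrite over_under.
rewrite [RHS](bigD1 (over c)) /=; last by rewrite /closed_arc eqxx.
rewrite [in RHS](bigD1 (under c)) /=; last first.
  by rewrite /closed_arc eqxx orbT eq_sym ou.
rewrite addrA {1 2}/esign /= addNr add0r; apply: eq_bigl => e.
rewrite /closed_arc cyclically3E /cyc3 -!position_eq.
have := ou; rewrite -position_eq; lia.
Qed.

Lemma LO_closed_arcC c : LO D c = \sum_(d | ~~ closed_arc c (over d)) - eps D d.
Proof.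
rewrite /LO; apply: eq_bigl => d.
have ou : over c != under c by rewrite over_under.
rewrite closed_arcE cyclically3E /cyc3; move: ou; rewrite -position_eq => ou.
have ud : (position D (under c) != position D (over d) :> nat).
  by rewrite position_eq eq_sym over_under.
case: ifP; lia.
Qed.

Section TwoChords.
Variables (i j : 'I_n) (ne_ij : i != j).
Let t e : int := esign D e.

Let sum_or_and (P Q : pred (endpoint n)) :
  \sum_(e | P e) t e + \sum_(e | Q e) t e =
  \sum_(e | P e || Q e) t e + \sum_(e | P e && Q e) t e.
Proof.
rewrite !(big_mkcond _ t) -!big_split; apply: eq_bigr => e _.
by case: (P e); case: (Q e); rewrite /= ?addr0 ?add0r.
Qed.

Lemma position_neqs :
  [/\ position D (over i) != position D (over j) :> nat,
      position D (over i) != position D (under j) :> nat,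
      position D (under i) != position D (over j) :> nat &
      position D (under i) != position D (under j) :> nat].
Proof.
rewrite !position_eq over_under [under i == over j]eq_sym over_under.
by rewrite !xpair_eqE (negPf ne_ij).
Qed.

(** In configuration A the two closed arcs are disjoint. *)
Lemma configA_sum : configA D i j ->
  \sum_(e | ~~ (closed_arc i e || closed_arc j e)) t e = - (Ind D i + Ind D j).
Proof.
rewrite /configA cyclically4E /cyc3 => A; have [h1 h2 h3 h4] := position_neqs.
rewrite [LHS]sum_esignC !Ind_closed_arc sum_or_and; congr (- _).
rewrite [X in _ = _ + X]big_pred0 ?addr0 // => e; rewrite !closed_arcE.
by do 2 case: ifP; lia.
Qed.

(** In configuration B the two closed arcs cover the circle, whose total sum of
signs is zero, so that the sum over their intersection is still
[Ind i + Ind j]. *)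
Lemma configB_sum : configB D i j ->
  \sum_(e | ~~ (closed_arc i e && closed_arc j e)) t e = - (Ind D i + Ind D j).
Proof.
rewrite /configB cyclically4E /cyc3 => B; have [h1 h2 h3 h4] := position_neqs.
rewrite [LHS]sum_esignC !Ind_closed_arc sum_or_and; congr (- _).
rewrite [X in _ = X + _](_ : _ = 0) ?add0r // -[RHS]sum_esign.
apply: eq_bigl => e; rewrite !closed_arcE.
by do 2 case: ifP; lia.
Qed.

End TwoChords.

Lemma rebase_subproof (b : 'I_(n.*2)) e :
  ((position D e + (n.*2 - b)) %% n.*2 < n.*2)%N.
Proof. by rewrite ltn_mod; have := ltn_ord b; lia. Qed.

Definition rebase_position b e := Ordinal (rebase_subproof b e).

Lemma rebaseE b e : rebase_position b e = shift n.*2 b (position D e) :> nat.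
Proof.
have := ltn_ord b; have := ltn_ord (position D e).
rewrite /= /shift; case: ifP => *; first by rewrite modn_small; lia.
have -> : (position D e + (n.*2 - b) = (position D e - b) + n.*2)%N by lia.
by rewrite modnDr modn_small; lia.
Qed.

Lemma rebase_inj b : injective (rebase_position b).
Proof.
move=> e e' /(congr1 (@nat_of_ord _)); rewrite !rebaseE /shift => eq_p.
apply/eqP; move: eq_p; rewrite -position_eq.
have := ltn_ord b; have := ltn_ord (position D e); have := ltn_ord (position D e').
by do 2 case: ifP; lia.
Qed.

(** The same diagram, read from position [b]. Every cyclic notion is unchanged,
and an arc that starts at [b] becomes an interval of positions. *)
Definition rebase b := GaussDiagram (@rebase_inj b) (positive D).

End Positions.

Section Rebase.
Variables (n : nat) (D : gauss_diagram n) (b : 'I_(n.*2)).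
Local Notation D' := (rebase D b).

Lemma rebase_arc_next : arc_next D' =2 arc_next D.
Proof.
move=> e e'; rewrite /arc_next -!val_eqE /=.
by have := rebaseE D b e'; have := rebaseE D b e; rewrite /= => -> ->; rewrite shift_succ.
Qed.

Lemma rebase_closed_arc c e : closed_arc D' c e = closed_arc D c e.
Proof. by rewrite /closed_arc !cyclically3E !rebaseE cyc3_shift. Qed.

Lemma rebase_configA i j : configA D' i j = configA D i j.
Proof. by rewrite /configA !cyclically4E !rebaseE !cyc3_shift. Qed.

Lemma rebase_configB i j : configB D' i j = configB D i j.
Proof. by rewrite /configB !cyclically4E !rebaseE !cyc3_shift. Qed.

End Rebase.

(** * Redirected determinants of a Gauss diagram *)

Section RedirectedMatrix.
Variables (R : comNzRingType) (n : nat) (D : gauss_diagram n) (w : endpoint n -> R).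
Implicit Types (c : 'I_n) (e : endpoint n) (S : {set 'I_n}).

Definition arc_entry e e' : R :=
  w e *+ (e' == e) - (arc_next D e e')%:R.

Definition redirect_entry S e e' : R :=
  if ~~ e.2 && (e.1 \in S) then (e' == over e.1)%:R else arc_entry e e'.

(** The determinant det A_S: the under-endpoints of the chords in [S] lead back to
the over-endpoints. *)
Definition redirect_det S : R := fdet (redirect_entry S).

(** Numbering the endpoints by position turns [redirect_det] into the determinant
of a cyclic matrix. *)
Lemma redirect_det_position S (f : 'I_(n.*2) -> endpoint n) :
  cancel f (position D) -> cancel (position D) f ->
  redirect_det S = \det (redirect_mx (fun x => w (f x))
    (fun x => ~~ (f x).2 && ((f x).1 \in S)) (fun x => position D (over (f x).1))).
Proof.
move=> fK Kf; rewrite /redirect_det (fdet_bij _ (Bijective fK Kf)).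
congr (\det _); apply/matrixP => x y; rewrite !mxE /redirect_entry.
case: ifP => _; first by rewrite -(can_eq Kf) fK.
by rewrite /arc_entry /arc_next (can_eq fK) !fK.
Qed.

Lemma redirect_det0 : (0 < n)%N -> redirect_det set0 = \prod_e w e - 1.
Proof.
move=> n0; have [f Kf fK] := position_bij D.
have N1 : (1 < n.*2)%N by lia.
rewrite (redirect_det_position _ fK Kf) [in RHS](reindex f) /=; last exact/onW_bij/(Bijective fK Kf).
rewrite -[RHS](det_redirect0 _ (fun x => position D (over (f x).1)) N1).
by congr (\det _); apply/matrixP => x y; rewrite !mxE inE andbF.
Qed.

(** [det_redirect] for the redirections [U_c -> O_c], with [M] the moved points
that are not redirected. *)
Lemma redirect_det_perm S (W M : pred 'I_(n.*2)) (s : 'S_(n.*2))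
   (U := [set position D (under c) | c in S]) : (0 < n)%N ->
  (forall x, M x = W x && (x \notin U)) ->
  (forall c, c \in S -> W (position D (under c))) ->
  (forall c, c \in S -> s (position D (under c)) = position D (over c)) ->
  (forall x, M x -> val (s x) = x.+1) ->
  (forall x, ~~ W x -> s x = x) ->
  (forall x, ~~ W x -> ~~ W (ordS x) -> (x.+1 < n.*2)%N) ->
  redirect_det S =
  (-1) ^+ s * (-1) ^+ #|M| * \prod_(e | ~~ W (position D e)) w e.
Proof.
move=> n0 ME WU sU sM sC wrapP; have [f Kf fK] := position_bij D.
have N1 : (1 < n.*2)%N by lia.
rewrite (redirect_det_position _ fK Kf).
have ZE x : ~~ (f x).2 && ((f x).1 \in S) = (x \in U).
  apply/idP/imsetP => [/andP[nx xS]|[c cS ->]]; last by rewrite Kf.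
  by exists (f x).1 => //; rewrite -[LHS]fK; case: (f x) nx => ? [].
rewrite (@det_redirect _ _ (fun x => w (f x)) _ W _ s N1); first last.
- exact: wrapP.
- exact: sC.
- by move=> x Wx; rewrite ZE => nUx; apply: sM; rewrite ME Wx.
- by move=> x; rewrite ZE => /imsetP[c cS ->]; rewrite Kf sU.
- by move=> x; rewrite ZE => /imsetP[c cS ->]; apply: WU.
congr (_ * _ * _); first by congr (_ ^+ _); apply: eq_card => x; rewrite [LHS]inE -[RHS]topredE /= ME ZE.
rewrite [RHS](reindex f) /=; last exact/onW_bij/(Bijective fK Kf).
by apply: eq_bigl => x; rewrite fK.
Qed.

End RedirectedMatrix.

Section RedirectedDeterminants.
Variables (R : comNzRingType) (n : nat) (D : gauss_diagram n) (w : endpoint n -> R).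
Implicit Types (c i j : 'I_n) (S : {set 'I_n}).

Lemma redirect_det_rebase b S : redirect_det (rebase D b) w S = redirect_det D w S.
Proof.
by apply: eq_fdet => e e'; rewrite /redirect_entry /arc_entry rebase_arc_next.
Qed.

Lemma rebase_over0 c : position (rebase D (position D (over c))) (over c) = 0%N :> nat.
Proof. by rewrite rebaseE /shift ltnn subnn. Qed.

(** The permutation is the cycle on the closed arc of [c]; its sign cancels the
entries [-1] along the arc. *)
Lemma redirect_det1_based c : position D (over c) = 0%N :> nat ->
  redirect_det D w [set c] = \prod_(e | ~~ closed_arc D c e) w e.
Proof.
move=> o0; pose o := position D (over c); pose u := position D (under c).
have u0 : (0 < u)%N by rewrite lt0n -o0 position_eq eq_sym over_under.
have [|s odds sE] := @interval_cycle _ o u; first by rewrite o0.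
rewrite (@redirect_det_perm _ _ _ _ _ (fun x => x <= u)%N (fun x => x < u)%N s).
- rewrite odds o0 [X in odd X](_ : _ = #|[pred x : 'I_n.*2 | x < u]%N|); last first.
    by apply: eq_card => x; rewrite !inE.
  rewrite signr_odd -expr2 sqrr_sign mul1r; apply: eq_bigl => e.
  by rewrite closed_arcE -/o -/u o0 u0.
- by have := ltn_ord c; lia.
- by move=> x; rewrite imset_set1 inE -val_eqE /= -/u; lia.
- by move=> d /set1P ->; rewrite -/u.
- move=> d /set1P ->; rewrite -/u; apply: val_inj; rewrite sE eqxx ltnn andbF.
  by [].
- by move=> x xu; rewrite sE o0 xu.
- by move=> x xu; apply: val_inj; rewrite sE -val_eqE /= !ifF //; lia.
move=> x xu; have := ltn_ord x; case: (x.+1 =P n.*2) => [xN|]; last by lia.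
by rewrite /= xN modnn.
Qed.

End RedirectedDeterminants.

Section SingleRedirection.
Variables (R : comNzRingType) (n : nat) (D : gauss_diagram n) (w : endpoint n -> R).
Implicit Types (c i j : 'I_n) (S : {set 'I_n}).

Lemma redirect_det1 c :
  redirect_det D w [set c] = \prod_(e | ~~ closed_arc D c e) w e.
Proof.
rewrite -(redirect_det_rebase D w (position D (over c))) redirect_det1_based ?rebase_over0 //.
by apply: eq_bigl => e; rewrite rebase_closed_arc.
Qed.

End SingleRedirection.

Section RedirectedPairs.
Variables (R : comNzRingType) (n : nat) (D : gauss_diagram n) (w : endpoint n -> R).
Implicit Types (c i j : 'I_n) (S : {set 'I_n}).

(** From position 0 the endpoints are met in the order O_i, U_i, O_j, U_j, and the
permutation is the product of the cycles on the two disjoint arcs. *)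
Lemma redirect_detA_based i j : i != j -> position D (over i) = 0%N :> nat ->
  configA D i j ->
  redirect_det D w [set i; j] =
  \prod_(e | ~~ (closed_arc D i e || closed_arc D j e)) w e.
Proof.
move=> ne_ij oi0; have [h1 h2 h3 h4] := position_neqs D ne_ij.
rewrite /configA cyclically4E /cyc3.
set oi := position D (over i) in oi0 h1 h2 *; set ui := position D (under i) in h3 h4 *.
set oj := position D (over j) in h1 h3 *; set uj := position D (under j) in h2 h4 *.
rewrite oi0 in h1 h2 * => order.
have [lt1 lt2 lt3] : [/\ 0 < ui, ui < oj & oj < uj]%N by split; lia.
have [|s odds sE] := @interval_cycle _ oi ui; first by rewrite oi0.
have [|t oddt tE] := @interval_cycle _ oj uj; first by lia.
have stE x : val ((s * t)%g x) =
    if (x < ui)%N || (oj <= x < uj)%N then x.+1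
    else if x == ui then 0%N else if x == uj then oj : nat else x.
  rewrite permM; have := tE (s x); have := sE x; rewrite -!val_eqE /= oi0 => -> ->.
  by do !case: ifP; lia.
rewrite (@redirect_det_perm _ _ _ _ _ (fun x => (x <= ui) || (oj <= x <= uj))%N
  (fun x => (x < ui) || (oj <= x < uj))%N (s * t)%g).
- set M := (X in #|X|).
  have -> : #|M| = (#|[pred x : 'I_n.*2 | oi <= x < ui]%N| + #|[pred x : 'I_n.*2 | oj <= x < uj]%N|)%N.
    rewrite -cardUI [X in (_ + X)%N]eq_card0 ?addn0; last by move=> x; rewrite !inE; lia.
    by apply: eq_card => x; rewrite !inE oi0.
  rewrite exprD odd_permM odds oddt signr_addb !signr_odd mulrACA -!expr2 !sqrr_sign !mul1r.
  by apply: eq_bigl => e; rewrite !closed_arcE -/oi -/ui -/oj -/uj oi0 lt1 lt3.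
- by have := ltn_ord i; lia.
- move=> x; rewrite imsetU1 imset_set1 !inE -!val_eqE /= -/ui -/uj; lia.
- by move=> d /set2P[] ->; rewrite -?/ui -?/uj; lia.
- move=> d /set2P[] ->; apply: val_inj; rewrite stE -?/ui -?/uj -?/oi -?/oj eqxx.
    by rewrite ifF // ; lia.
  by rewrite ifF; [case: eqP => // e; rewrite -e in lt2 lt3; lia | lia].
- by move=> x xM; rewrite stE xM.
- by move=> x xW; apply: val_inj; rewrite stE -!val_eqE /=; do !case: ifP; lia.
move=> x xW; have := ltn_ord x; case: (x.+1 =P n.*2) => [xN|]; last by lia.
by rewrite /= xN modnn.
Qed.

(** From position 0 the endpoints are met in the order O_i, U_j, O_j, U_i. The
cycles on [O_i, U_j] and [O_j, U_i] return to the wrong over-endpoints; the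
transposition of O_i and O_j corrects this, joins the two cycles into one, and
causes the sign. *)
Lemma redirect_detB_based i j : i != j -> position D (over i) = 0%N :> nat ->
  configB D i j ->
  redirect_det D w [set i; j] =
  - \prod_(e | ~~ (closed_arc D i e && closed_arc D j e)) w e.
Proof.
move=> ne_ij oi0; have [h1 h2 h3 h4] := position_neqs D ne_ij.
rewrite /configB cyclically4E /cyc3.
set oi := position D (over i) in oi0 h1 h2 *; set ui := position D (under i) in h3 h4 *.
set oj := position D (over j) in h1 h3 *; set uj := position D (under j) in h2 h4 *.
have ne_oo : oi != oj by rewrite -val_eqE.
rewrite oi0 in h1 h2 * => order.
have [lt1 lt2 lt3] : [/\ 0 < uj, uj < oj & oj < ui]%N by split; lia.
have [|s odds sE] := @interval_cycle _ oi uj; first by rewrite oi0.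
have [|t oddt tE] := @interval_cycle _ oj ui; first by lia.
have stE x : val ((s * t * tperm oi oj)%g x) =
    if (x < uj)%N || (oj <= x < ui)%N then x.+1
    else if x == ui then 0%N else if x == uj then oj : nat else x.
  have : val ((s * t)%g x) = if (x < uj)%N || (oj <= x < ui)%N then x.+1
    else if x == uj then 0%N else if x == ui then oj : nat else x.
    rewrite permM; have := tE (s x); have := sE x; rewrite -!val_eqE /= oi0 => -> ->.
    by do !case: ifP; lia.
  rewrite [(s * t * _)%g x]permM; move: ((s * t)%g x) => y.
  rewrite -!val_eqE /=; case: tpermP => [-> | -> | /eqP + /eqP +]; rewrite -?val_eqE /= ?oi0.
  - by do !case: ifP; lia.
  - by do !case: ifP; lia.
  by move=> + + yE; rewrite yE; do !case: ifP; lia.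
rewrite (@redirect_det_perm _ _ _ _ _ (fun x => (x <= uj) || (oj <= x <= ui))%N
  (fun x => (x < uj) || (oj <= x < ui))%N (s * t * tperm oi oj)%g).
- set M := (X in #|X|).
  have -> : #|M| = (#|[pred x : 'I_n.*2 | oi <= x < uj]%N| + #|[pred x : 'I_n.*2 | oj <= x < ui]%N|)%N.
    rewrite -cardUI [X in (_ + X)%N]eq_card0 ?addn0; last by move=> x; rewrite !inE; lia.
    by apply: eq_card => x; rewrite !inE oi0.
  rewrite exprD !odd_permM odds oddt odd_tperm ne_oo !signr_addb !signr_odd expr1 mulrN1 mulNr.
  rewrite mulrACA -!expr2 !sqrr_sign mulNr !mul1r; congr (- _).
  apply: eq_bigl => e; rewrite !closed_arcE -/oi -/ui -/oj -/uj oi0; congr (~~ _).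
  by do 2 case: ifP; lia.
- by have := ltn_ord i; lia.
- move=> x; rewrite imsetU1 imset_set1 !inE -!val_eqE /= -/ui -/uj; lia.
- by move=> d /set2P[] ->; rewrite -?/ui -?/uj; lia.
- move=> d /set2P[] ->; apply: val_inj; rewrite stE -?/ui -?/uj -?/oi -?/oj eqxx.
    by rewrite ifF // ; lia.
  by rewrite ifF; [case: eqP => // e; rewrite -e in lt2 lt3; lia | lia].
- by move=> x xM; rewrite stE xM.
- by move=> x xW; apply: val_inj; rewrite stE -!val_eqE /=; do !case: ifP; lia.
move=> x xW; have := ltn_ord x; case: (x.+1 =P n.*2) => [xN|]; last by lia.
by rewrite /= xN modnn.
Qed.

(** Suppose that a run [I] of consecutive positions, together with one more point
[z], contains both over-endpoints and is closed under taking successors from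
[I]. If the two under-endpoints are outside [I], then they and [I] are
[#|I| + 2] rows supported in at most [#|I| + 1] columns. *)
Lemma redirect_det_hall i j (I : {set 'I_(n.*2)}) z : i != j ->
  position D (under i) \notin I -> position D (under j) \notin I ->
  position D (over i) \in z |: I -> position D (over j) \in z |: I ->
  (forall x, x \in I -> ordS x \in z |: I) ->
  redirect_det D w [set i; j] = 0.
Proof.
move=> ne_ij nui nuj oi oj IS; have [f Kf fK] := position_bij D.
rewrite (redirect_det_position w _ fK Kf).
pose X := position D (under i) |: (position D (under j) |: I).
apply: (@det0_hall _ _ _ X (z |: I)).
  rewrite !cardsU1 nuj !inE negb_or nui andbT (inj_eq (@position_inj _ D)).
  rewrite xpair_eqE (negPf ne_ij) /=.
  by case: (z \notin I); lia.
have under_row c y : c \in [set i; j] -> position D (over c) \in z |: I -> y \notin z |: I ->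
    redirect_mx (fun x => w (f x)) (fun x => ~~ (f x).2 && ((f x).1 \in [set i; j]))
      (fun x => position D (over (f x).1)) (position D (under c)) y = 0.
  move=> cS oc ny; rewrite mxE Kf /= cS.
  by case: eqP => // yE; rewrite yE oc in ny.
move=> x y /setU1P[->|/setU1P[->|xI]] ny.
- by apply: under_row => //; rewrite set21.
- by apply: under_row => //; rewrite set22.
rewrite mxE.
have ySx : (y == ordS x) = false by apply: contraNF ny => /eqP ->; rewrite IS.
have yx : (y == x) = false by apply: contraNF ny => /eqP ->; rewrite in_setU1 xI orbT.
rewrite ySx yx mulr0n subr0; case: ifP => // /andP[].
case fx : (f x) => [c []] //= _ /set2P cij.
have xE : x = position D (under c) by rewrite -[LHS]fK fx.
by case: cij xE xI nui nuj => -> -> ->.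
Qed.

Lemma redirect_det_neither_based i j : i != j -> position D (over i) = 0%N :> nat ->
  ~~ configA D i j -> ~~ configB D i j -> redirect_det D w [set i; j] = 0.
Proof.
move=> ne_ij oi0; have [h1 h2 h3 h4] := position_neqs D ne_ij.
rewrite /configA /configB !cyclically4E /cyc3.
have := position_eq D (over i) (under i); have := position_eq D (over j) (under j).
rewrite !over_under.
set oi := position D (over i) in oi0 h1 h2 *; set ui := position D (under i) in h3 h4 *.
set oj := position D (over j) in h1 h3 *; set uj := position D (under j) in h2 h4 *.
rewrite oi0 in h1 h2 * => hj hi nA nB.
have N0 : (0 < n.*2)%N by have := ltn_ord oi; lia.
have [[lt1 lt2]|[lt1 lt2]] : (oj < ui /\ oj < uj)%N \/ (ui < oj /\ uj < oj)%N by lia.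
(* One of the over-endpoints follows the other with no under-endpoint between
   them: O_j follows O_i in the first case, O_i follows O_j in the second. *)
- apply: (@redirect_det_hall i j [set x : 'I_(n.*2) | x < oj]%N oj) => //;
    rewrite -?/oi -?/oj -?/ui -?/uj ?inE -?val_eqE /= ?oi0 ?eqxx //; try lia.
  by move=> x; rewrite !inE -!val_eqE /= modn_succ //; have := ltn_ord oj; case: (_ =P n.*2); lia.
apply: (@redirect_det_hall i j [set x : 'I_(n.*2) | oj <= x]%N oi) => //;
  rewrite -?/oi -?/oj -?/ui -?/uj ?inE -?val_eqE /= ?oi0 ?eqxx //; try lia.
by move=> x; rewrite !inE -!val_eqE /= modn_succ // oi0; case: (_ =P n.*2); lia.
Qed.

End RedirectedPairs.

Section PairRedirection.
Variables (R : comNzRingType) (n : nat) (D : gauss_diagram n) (w : endpoint n -> R).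

Lemma redirect_det2 i j : i != j ->
  redirect_det D w [set i; j] =
  if configA D i j then \prod_(e | ~~ (closed_arc D i e || closed_arc D j e)) w e
  else if configB D i j then
    - \prod_(e | ~~ (closed_arc D i e && closed_arc D j e)) w e
  else 0.
Proof.
move=> ne_ij; pose D' := rebase D (position D (over i)).
have oi0 : position D' (over i) = 0%N :> nat by apply: rebase_over0.
rewrite -(redirect_det_rebase D w (position D (over i))) -/D'.
rewrite -(rebase_configA D (position D (over i))) -(rebase_configB D (position D (over i))) -/D'.
case: ifPn => [A|nA]; last case: ifPn => [B|nB].
- by rewrite redirect_detA_based //; apply: eq_bigl => e; rewrite !rebase_closed_arc.
- by rewrite redirect_detB_based //; congr (- _); apply: eq_bigl => e; rewrite !rebase_closed_arc.
exact: redirect_det_neither_based.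
Qed.

End PairRedirection.

(** * The Alexander matrix *)

Section AlexanderMatrix.
Variables (n : nat) (D : gauss_diagram n).

(** [U k l] stands for the monomial u^k v^l, and only its multiplicativity will be
used; the determinant is then expanded over an arbitrary commutative ring. *)
Definition weight (R : Type) (U : int -> int -> R) (e : endpoint n) : R :=
  if e.2 then U 0 (- eps D e.1) else U (- eps D e.1) 0.

Lemma in_arc_inj i j (a b : 'I_2) : in_arc D i a = in_arc D j b -> i = j /\ a = b.
Proof.
case=> <-; split=> //; apply: val_inj.
case: (positive D i) H => H; move: H; rewrite -!val_eqE;
by case: a b => [[|[|?]] ?] [[|[|?]] ?].
Qed.

Definition arc_of (k : 'I_(\sum_(i < n) 2)) : endpoint n :=
  in_arc D (tagnat.sig1 k) (tagnat.sig2 k).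

Lemma arc_of_bij : bijective arc_of.
Proof.
apply: inj_card_bij; last first.
  by rewrite card_prod card_bool !card_ord sum_nat_const card_ord.
move=> k l /in_arc_inj; move=> [e1 e2]; apply: (@tagnat.sig_inj n (fun=> 2)).
rewrite !tagnat.sigE12; move: e1 e2.
by move: (tagnat.sig1 k) (tagnat.sig1 l) (tagnat.sig2 k) (tagnat.sig2 l) => i j a b /= -> ->.
Qed.

(** Whatever the sign of the crossing, its block has u^(-eps) on the diagonal at
the incoming under-strand, v^(-eps) at the incoming over-strand, and
1 - (uv)^(-eps) as its only other entry, in the row of the under-strand. *)
Lemma Delta0_fdet : (0 < n)%N ->
  Delta0 D = fdet (fun e e' => arc_entry D (weight uv_) e e' +
    (if e.2 then 0 else (1 - uv_ (- eps D e.1) (- eps D e.1)) * (e' == over e.1)%:R)).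
Proof.
rewrite lt0n /Delta0 => /negPf ->; rewrite (fdet_bij _ arc_of_bij).
congr (\det _); apply/matrixP => k l; rewrite !mxE /arc_entry addrAC.
congr (_ - _); rewrite /arc_of.
move: (tagnat.sig1 k) (tagnat.sig1 l) (tagnat.sig2 k) (tagnat.sig2 l) => i j a b /=.
case: eqVneq => [<-|ne_ij]; last first.
  by rewrite !mxE /weight /in_arc !xpair_eqE !(eq_sym j) (negPf ne_ij) /= mulr0 mulr0n add0r if_same.
rewrite conform_mx_id /crossing_block /weight /in_arc /eps !xpair_eqE eqxx /=.
case: (positive D i); rewrite mxE ?opprK.
  move: (uv_ (-1) 0) (uv_ 0 (-1)) (uv_ (-1) (-1)) => x y z.
  by case: a b => [[|[|?]] ?] [[|[|?]] ?] //=;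
    rewrite ?mulr1n ?mulr0n ?mulr1 ?mulr0 ?addr0 ?add0r.
move: (uv_ 1 0) (uv_ 0 1) (uv_ 1 1) => x y z.
by case: a b => [[|[|?]] ?] [[|[|?]] ?] //=;
  rewrite ?mulr1n ?mulr0n ?mulr1 ?mulr0 ?addr0 ?add0r.
Qed.

End AlexanderMatrix.

(** * Congruences modulo the cube of an element *)

Section ModCube.
Variables (R : comNzRingType) (h : R).
Implicit Types f g r : R.

Definition eqmod_cube f g := exists r, f = g + h ^+ 3 * r.

Lemma eqmod_cube_refl f : eqmod_cube f f.
Proof. by exists 0; rewrite mulr0 addr0. Qed.

Lemma eqmod_cubeD f1 f2 g1 g2 : eqmod_cube f1 g1 -> eqmod_cube f2 g2 -> eqmod_cube (f1 + f2) (g1 + g2).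
Proof. by move=> [r1 ->] [r2 ->]; exists (r1 + r2); rewrite mulrDr addrACA. Qed.

Lemma eqmod_cube_sum (I : finType) (P : pred I) (F G : I -> R) :
  (forall i, P i -> eqmod_cube (F i) (G i)) -> eqmod_cube (\sum_(i | P i) F i) (\sum_(i | P i) G i).
Proof.
move=> FG; elim/big_rec2: _ => [|i f g Pi IH]; first exact: eqmod_cube_refl.
by apply: eqmod_cubeD => //; apply: FG.
Qed.

Lemma eqmod_cube_succ k t f p : p * (1 - h) = 1 ->
  eqmod_cube f (1 + h * k + h ^+ 2 * t) ->
  eqmod_cube (f * p) (1 + h * (k + 1) + h ^+ 2 * (t + (k + 1))).
Proof.
move=> ph [r ->].
have -> : p = 1 + h + h ^+ 2 + h ^+ 3 * p.
  have : (1 + h + h ^+ 2) * (p * (1 - h)) = 1 + h + h ^+ 2 by rewrite ph mulr1.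
  by move=> <-; ring.
exists ((k + t) + t * h + p * (1 + h * k + h ^+ 2 * t) + r * (1 + h + h ^+ 2 + h ^+ 3 * p)).
ring.
Qed.

Lemma eqmod_cube_pred k t f :
  eqmod_cube f (1 + h * k + h ^+ 2 * t) ->
  eqmod_cube (f * (1 - h)) (1 + h * (k - 1) + h ^+ 2 * (t - k)).
Proof. by move=> [r ->]; exists (r * (1 - h) - t); ring. Qed.

(** The contribution of one chord: [x] and [y] will be q^(-eps c) and
q^(LO c), and [u] will be u^(Ind c). *)
Lemma eqmod_cube_single u k t l s x y :
  eqmod_cube x (1 + h * k + h ^+ 2 * t) -> eqmod_cube y (1 + h * l + h ^+ 2 * s) ->
  eqmod_cube ((1 - x) * (u * y)) (- (h * (k * u)) + h ^+ 2 * ((- (k * l) - t) * u)).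
Proof.
move=> [r ->] [r' ->].
exists (- u * ((k * s + t * l + h * t * s) + (h * k + h ^+ 2 * t) * r' +
               r * (1 + h * l + h ^+ 2 * s + h ^+ 3 * r'))).
ring.
Qed.

End ModCube.

Definition triangular (k : int) : int := ((k * (k + 1)) %/ 2)%Z.

Lemma triangularS k : triangular (k + 1) = triangular k + (k + 1).
Proof.
rewrite /triangular [RHS]addrC -divzMDl //; congr (_ %/ _)%Z; ring.
Qed.

Lemma triangularP k : triangular (k - 1) = triangular k - k.
Proof. by have := triangularS (k - 1); rewrite subrK => ->; rewrite addrK. Qed.

(** The binomial expansion of (1 - h)^(-k) to second order, for [k] of either
sign. *)
Lemma eqmod_cube_character (R : comNzRingType) (Q : int -> R) :
  Q 0 = 1 -> {morph Q : k l / k + l >-> k * l} -> forall k,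
  eqmod_cube (1 - Q 1) (Q (- k)) (1 + (1 - Q 1) * k%:~R + (1 - Q 1) ^+ 2 * (triangular k)%:~R).
Proof.
move=> Q0 QD; set h := 1 - Q 1.
have Q1 : Q 1 = 1 - h by rewrite subKr.
have QN1 : Q (-1) * (1 - h) = 1 by rewrite -Q1 -QD.
elim=> [|k IH|k IH].
- by exists 0; rewrite oppr0 Q0 !mulr0 !addr0.
- by rewrite -addn1 PoszD triangularS !intrD opprD QD; apply: eqmod_cube_succ.
rewrite -addn1 PoszD opprD triangularP !intrB.
by rewrite [- (- _ - 1)]opprD [- -1]opprK QD Q1; apply: eqmod_cube_pred.
Qed.

(** * Second-order expansion of the determinant *)

Section SubsetSums.
Variables (n : nat) (V : zmodType) (F : {set 'I_n} -> V).

Lemma sum_subsets_by_card :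
  \sum_S F S = F set0 + \sum_i F [set i] +
    \sum_(i < n) \sum_(j < n | (i < j)%N) F [set i; j] + \sum_(S : {set 'I_n} | (2 < #|S|)%N) F S.
Proof.
rewrite (bigID (fun S : {set 'I_n} => 2 < #|S|)%N) /= addrC; congr (_ + _).
rewrite (bigID (fun S : {set 'I_n} => #|S| == 2)%N) /= addrC; congr (_ + _).
  rewrite (bigD1 set0) /=; last by rewrite cards0.
  congr (_ + _); rewrite -(big_imset _ (in2W (@set1_inj _))) /=.
  apply: eq_bigl => S; rewrite -cards_eq0; apply/idP/imsetP => [/andP[cS S0]|[i _ ->]].
    have /cards1P[i ->] : #|S| == 1%N by move: (#|S|) cS S0 => k; lia.
    by exists i.
  by rewrite cards1.
rewrite pair_big_dep /=.
pose P := [set p : 'I_n * 'I_n | (p.1 < p.2)%N].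
have inj : {in P &, injective (fun p : 'I_n * 'I_n => [set p.1; p.2])}.
  move=> [a b] [c d]; rewrite !inE /= => ab cd /setP eS.
  have := eS a; have := eS b; have := eS c; have := eS d.
  rewrite !inE !eqxx ?orbT /= -!val_eqE /= => h1 h2 h3 h4.
  by congr (_, _); apply: val_inj => /=; lia.
transitivity (\sum_(p in P) F [set p.1; p.2]); last by apply: eq_bigl => p; rewrite inE.
rewrite -(big_imset _ inj) /=; apply: eq_bigl => S.
apply/idP/imsetP => [/andP[_ /cards2P[a [b [ne_ab ->]]]]|[[a b]]].
  have [ab|ab] : (a < b \/ b < a)%N by rewrite -val_eqE /= in ne_ab; lia.
    by exists (a, b); rewrite ?inE.
  by exists (b, a); rewrite ?inE //= setUC.
by rewrite inE /= => ab ->; rewrite cards2 -val_eqE /=; case: eqP; lia.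
Qed.

End SubsetSums.

Section Expansion.
Variables (n : nat) (D : gauss_diagram n).
Implicit Types (c i j d : 'I_n) (e : endpoint n).
Variables (R : comNzRingType) (U : int -> int -> R).
Hypotheses (U0 : U 0 0 = 1)
  (UD : forall k l k' l', U (k + k') (l + l') = U k l * U k' l').

Local Notation h := (1 - U 1 1).
Local Notation wt := (weight D U).

Lemma sum_endpoints (V : nmodType) (F : endpoint n -> V) :
  \sum_e F e = \sum_c (F (over c) + F (under c)).
Proof.
transitivity (\sum_c \sum_b F (c, b)); last by apply: eq_bigr => c _; rewrite big_bool.
by rewrite pair_bigA; apply: eq_bigr => -[].
Qed.

Lemma U_prod (I : finType) (P : pred I) (f g : I -> int) :
  \prod_(i | P i) U (f i) (g i) = U (\sum_(i | P i) f i) (\sum_(i | P i) g i).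
Proof. by elim/big_rec3: _ => // i x y z _ ->; rewrite UD. Qed.

(** Separating a power of u, recording the sign of the endpoint, from a power of
uv, to which only over-endpoints contribute: this is where [LO] comes from. *)
Lemma weight_split e :
  wt e = U (- esign D e) 0 * U (if e.2 then - eps D e.1 else 0) (if e.2 then - eps D e.1 else 0).
Proof.
by rewrite -UD add0r /weight /esign; case: e.2; rewrite ?opprK ?subrr ?addr0.
Qed.

Lemma prod_weight (P : pred (endpoint n)) (z := \sum_(d | P (over d)) - eps D d) :
  \prod_(e | P e) wt e = U (- \sum_(e | P e) esign D e) 0 * U z z.
Proof.
have zE : \sum_(e | P e) (if e.2 then - eps D e.1 else 0) = z.
  rewrite big_mkcond sum_endpoints [RHS]big_mkcond.
  by apply: eq_bigr => d _ /=; rewrite if_same addr0.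
under eq_bigr => e _ do rewrite weight_split.
by rewrite big_split !U_prod /= sumrN big1_eq zE.
Qed.

Lemma weight_closed_arcC c :
  \prod_(e | ~~ closed_arc D c e) wt e = U (Ind D c) 0 * U (LO D c) (LO D c).
Proof. by rewrite prod_weight sum_esignC opprK -Ind_closed_arc -LO_closed_arcC. Qed.

Lemma prod_all_weights : \prod_e wt e = U (- Wr D) (- Wr D).
Proof. by rewrite prod_weight sum_esign oppr0 U0 sumrN mul1r. Qed.

(** The quotient of 1 - (uv)^(-eps c) by 1 - uv. *)
Definition redirect_coef c : R := if positive D c then - U (-1) (-1) else 1.

Lemma redirect_coefE c : 1 - U (- eps D c) (- eps D c) = h * redirect_coef c.
Proof.
rewrite /redirect_coef /eps; case: (positive D c); last by rewrite opprK mulr1.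
by rewrite mulrN mulrBl -UD subrr U0 mul1r opprB.
Qed.

Definition pair_term i j : R :=
  redirect_coef i * redirect_coef j * redirect_det D wt [set i; j].

(** The coefficient of h^2 in the determinant. The powers of uv that remain inside
[pair_term] are left unexpanded, as they specialize to 1. *)
Definition second_coef : R :=
  (triangular (Wr D))%:~R
  + \sum_c (eps D c * LO D c - triangular (eps D c))%:~R * U (Ind D c) 0
  + \sum_(i < n) \sum_(j < n | (i < j)%N) pair_term i j.

Definition alexander_det : R :=
  fdet (fun e e' => arc_entry D wt e e' +
    (if e.2 then 0 else (1 - U (- eps D e.1) (- eps D e.1)) * (e' == over e.1)%:R)).

Lemma alexander_det_expand :
  alexander_det = \sum_(S : {set 'I_n})
    (\prod_(c in S) (1 - U (- eps D c) (- eps D c))) * redirect_det D wt S.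
Proof.
exact: (fdet_expand (arc_entry D wt) (fun e e' => (e' == over e.1)%:R)
  (fun c => 1 - U (- eps D c) (- eps D c))).
Qed.

Lemma U_expand k : eqmod_cube h (U (- k) (- k)) (1 + h * k%:~R + h ^+ 2 * (triangular k)%:~R).
Proof. by apply: (@eqmod_cube_character _ (fun k => U k k)) => // x y; rewrite UD. Qed.

(** The empty set, the singletons and the pairs are expanded separately; any larger
set of chords contributes a multiple of h^3. *)
Lemma alexander_det_eqmod_cube : (0 < n)%N ->
  eqmod_cube h alexander_det
    (h * ((Wr D)%:~R - \sum_c (eps D c)%:~R * U (Ind D c) 0) + h ^+ 2 * second_coef).
Proof.
move=> n0; rewrite alexander_det_expand sum_subsets_by_card.
pose f0 : R := h * (Wr D)%:~R + h ^+ 2 * (triangular (Wr D))%:~R.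
pose f1 c : R := - (h * ((eps D c)%:~R * U (Ind D c) 0)) +
   h ^+ 2 * ((- ((eps D c)%:~R * (- LO D c)%:~R) - (triangular (eps D c))%:~R) * U (Ind D c) 0).
pose f2 i j : R := h ^+ 2 * pair_term i j.
rewrite [X in eqmod_cube _ _ X](_ : _ =
    f0 + \sum_c f1 c + \sum_(i < n) \sum_(j < n | (i < j)%N) f2 i j + 0).
  apply: eqmod_cubeD; first apply: eqmod_cubeD; first apply: eqmod_cubeD.
  - rewrite big_set0 mul1r redirect_det0 // prod_all_weights.
    by have [r ->] := U_expand (Wr D); exists r; rewrite /f0; ring.
  - apply: eqmod_cube_sum => c _; rewrite big_set1 redirect_det1 weight_closed_arcC.
    apply: eqmod_cube_single; first exact: U_expand.
    by have := U_expand (- LO D c); rewrite opprK; apply.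
  - apply: eqmod_cube_sum => i _; apply: eqmod_cube_sum => j ij.
    rewrite big_setU1 ?inE /=; last by rewrite -val_eqE /= neq_ltn ij.
    rewrite big_set1 !redirect_coefE /f2 /pair_term; exists 0; ring.
  have sum0 : \sum_(S : {set 'I_n} | (2 < #|S|)%N) 0 = 0 :> R by rewrite big1_eq.
  rewrite -[X in eqmod_cube _ _ X]sum0.
  apply: eqmod_cube_sum => S S2.
  under eq_bigr => c _ do rewrite redirect_coefE.
  rewrite big_split /= prodr_const -(subnK S2) addnC exprD.
  by eexists; rewrite add0r -!mulrA; reflexivity.
have sum1 : \sum_c f1 c = - (h * \sum_c (eps D c)%:~R * U (Ind D c) 0) +
    h ^+ 2 * \sum_c (eps D c * LO D c - triangular (eps D c))%:~R * U (Ind D c) 0.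
  rewrite !mulr_sumr -sumrN -big_split; apply: eq_bigr => c _; rewrite /f1 /=.
  by rewrite !(intrB, intrM, intrN) mulrN opprK.
have sum2 : \sum_(i < n) \sum_(j < n | (i < j)%N) f2 i j =
    h ^+ 2 * \sum_(i < n) \sum_(j < n | (i < j)%N) pair_term i j.
  by rewrite mulr_sumr; apply: eq_bigr => i _; rewrite mulr_sumr.
rewrite sum1 sum2 /f0 /second_coef; ring.
Qed.

(** From here on, [phi] is the specialization at v = u^(-1) and [T k] stands for
t^k. *)
Variables (S : comNzRingType) (T : int -> S) (phi : {rmorphism R -> S}).
Hypothesis phiU : forall k l, phi (U k l) = T (k - l).
Hypothesis T0 : T 0 = 1.

Lemma phi_prod_weight (P : pred (endpoint n)) :
  phi (\prod_(e | P e) wt e) = T (- \sum_(e | P e) esign D e).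
Proof. by rewrite prod_weight rmorphM /= !phiU subr0 subrr T0 mulr1. Qed.

Lemma phi_redirect_coef c : phi (redirect_coef c) = (- eps D c)%:~R.
Proof.
rewrite /redirect_coef /eps; case: (positive D c); last by rewrite opprK rmorph1.
by rewrite rmorphN /= phiU subrr T0 intrN.
Qed.

Lemma configA_notB i j : configA D i j -> configB D i j = false.
Proof. by rewrite /configA /configB !cyclically4E /cyc3; lia. Qed.

Lemma phi_pair_term i j : (i < j)%N ->
  phi (pair_term i j) =
    (if configA D i j then (eps D i * eps D j)%:~R * T (Ind D i + Ind D j) else 0)
  - (if configB D i j then (eps D i * eps D j)%:~R * T (Ind D i + Ind D j) else 0).
Proof.
move=> lt_ij; have ne_ij : i != j by rewrite -val_eqE /= neq_ltn lt_ij.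
rewrite /pair_term 2![in LHS]rmorphM /= !phi_redirect_coef !intrN mulrNN -intrM redirect_det2 //.
case: ifPn => [A|nA].
  by rewrite configA_notB // subr0 phi_prod_weight configA_sum // opprK.
rewrite sub0r; case: ifPn => [B|nB]; last by rewrite rmorph0 mulr0 oppr0.
by rewrite rmorphN /= phi_prod_weight configB_sum // opprK mulrN.
Qed.

Lemma phi_second_coef : phi second_coef =
  ((Wr D * (Wr D + 1)) %/ 2)%Z%:~R
  + \sum_(c < n) (eps D c * (LO D c - ((1 + eps D c) %/ 2)%Z))%:~R * T (Ind D c)
  + \sum_(i < n) \sum_(j < n | (i < j)%N && configA D i j)
      (eps D i * eps D j)%:~R * T (Ind D i + Ind D j)
  - \sum_(i < n) \sum_(j < n | (i < j)%N && configB D i j)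
      (eps D i * eps D j)%:~R * T (Ind D i + Ind D j).
Proof.
rewrite /second_coef !rmorphD /= rmorph_int -!addrA; congr (_ + _).
rewrite !rmorph_sum /=; congr (_ + _).
  (* As eps = 1 or -1, both [triangular eps] and [eps * ((1 + eps) / 2)] are
     1 or 0. *)
  apply: eq_bigr => c _; rewrite rmorphM /= rmorph_int phiU subr0; congr (_%:~R * _).
  by rewrite /eps; case: (positive D c); rewrite /triangular mulrBr.
rewrite -sumrB; apply: eq_bigr => i _; rewrite !big_mkcondr -sumrB rmorph_sum.
by apply: eq_bigr => j lt_ij; apply: phi_pair_term.
Qed.

End Expansion.

(** * Ring morphisms out of a group ring *)

Section LaurentTheory.
Variable G : zmodType.
Implicit Types (f g : laurent G) (k l : G) (c : int).

Lemma monomialD k l : monomial (k + l) = monomial k * monomial l.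
Proof. by rewrite [RHS]laurent_mulUU mulr1. Qed.

Lemma monomial0 : monomial (0 : G) = 1.
Proof. by []. Qed.

Lemma mcoeff_monomialM k f l : (monomial k * f)@_l = f@_(l - k).
Proof.
elim/laurent_ind: f => [|f g IHf IHg|k' c].
- by rewrite mulr0 !mcoeff0.
- by rewrite mulrDr !mcoeffD IHf IHg.
by rewrite [_ * _]laurent_mulUU mul1r !mcoeffU [k' == _]eq_sym subr_eq eq_sym addrC.
Qed.

Section Extension.
Variables (S : comNzRingType) (h : G -> S).
Hypotheses (h0 : h 0 = 1) (hD : {morph h : k l / k + l >-> k * l}).

(** The linear extension of [h]; both [in_u] and [eval_t_tinv] are of this form. *)
Definition laurent_lift (f : laurent G) : S := mmap intr h f.

Lemma laurent_lift_is_zmod_morphism : zmod_morphism laurent_lift.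
Proof. exact: mmapB. Qed.

Lemma laurent_lift_monomial k : laurent_lift (monomial k) = h k.
Proof. by rewrite /laurent_lift mmapU mul1r. Qed.

Lemma laurent_lift_is_monoid_morphism : monoid_morphism laurent_lift.
Proof.
split=> [|f g]; first by rewrite -monomial0 laurent_lift_monomial h0.
have liftD := mmapD (f := intr) (h := h).
elim/laurent_ind: f => [|f1 f2 IH1 IH2|k a].
- by rewrite mul0r /laurent_lift mmap0 mul0r.
- by rewrite mulrDl /laurent_lift !liftD -!/(laurent_lift _) IH1 IH2 mulrDl.
elim/laurent_ind: g => [|g1 g2 IH1 IH2|l b].
- by rewrite mulr0 /laurent_lift mmap0 mulr0.
- by rewrite mulrDr /laurent_lift !liftD -!/(laurent_lift _) IH1 IH2 mulrDr.
by rewrite [_ * _]laurent_mulUU /laurent_lift !mmapU /= intrM hD mulrACA.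
Qed.

End Extension.
End LaurentTheory.

Lemma t_D k l : t_ (k + l) = t_ k * t_ l.
Proof. exact: monomialD. Qed.

Lemma uv_D k l k' l' : uv_ (k + k') (l + l') = uv_ k l * uv_ k' l'.
Proof. exact: (@monomialD _ (k, l) (k', l')). Qed.

Fact in_u_hD : {morph (fun k => uv_ k 0) : k l / k + l >-> k * l}.
Proof. by move=> k l; rewrite -uv_D addr0. Qed.

HB.instance Definition _ := GRing.isZmodMorphism.Build (laurent int) laurent2
  in_u (laurent_lift_is_zmod_morphism _).
HB.instance Definition _ := GRing.isMonoidMorphism.Build (laurent int) laurent2
  in_u (@laurent_lift_is_monoid_morphism _ _ (fun k => uv_ k 0) erefl in_u_hD).

Fact eval_hD : {morph (fun k : int * int => t_ k.1 * t_ (- k.2)) : k l / k + l >-> k * l}.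
Proof. by move=> k l /=; rewrite opprD !t_D mulrACA. Qed.
Fact eval_h0 : t_ 0 * t_ (- 0) = 1.
Proof. by rewrite -t_D. Qed.

HB.instance Definition _ := GRing.isZmodMorphism.Build laurent2 (laurent int)
  eval_t_tinv (laurent_lift_is_zmod_morphism _).
HB.instance Definition _ := GRing.isMonoidMorphism.Build laurent2 (laurent int)
  eval_t_tinv (@laurent_lift_is_monoid_morphism _ _
    (fun k : int * int => t_ k.1 * t_ (- k.2)) eval_h0 eval_hD).

Lemma in_u_t k : in_u (t_ k) = uv_ k 0.
Proof. exact: (laurent_lift_monomial (fun k => uv_ k 0)). Qed.

Lemma eval_uv k l : eval_t_tinv (uv_ k l) = t_ (k - l).
Proof. by rewrite [LHS]laurent_lift_monomial /= -t_D. Qed.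

Local Notation h_ := (1 - uv_ 1 1).

Lemma eval_h : eval_t_tinv h_ = 0.
Proof. by rewrite rmorphB rmorph1 /= eval_uv subrr. Qed.

(** If [h f = 0] then the coefficients of [f] are constant along the direction
(1, 1), so a nonzero one would give [f] an infinite support. *)
Lemma one_sub_uv_regular (f g : laurent2) : h_ * f = h_ * g -> f = g.
Proof.
suff reg (f0 : laurent2) : h_ * f0 = 0 -> f0 = 0.
  by move=> /eqP; rewrite -subr_eq0 -mulrBr => /eqP/reg/eqP; rewrite subr_eq0 => /eqP.
move: f0 => {}f; rewrite mulrBl mul1r => /eqP; rewrite subr_eq0 => /eqP fE.
have shift k (j : nat) : f@_(k - (j%:Z, j%:Z)) = f@_k.
  elim: j => [|j <-]; first by rewrite subr0.
  rewrite [in RHS]fE mcoeff_monomialM -addrA -opprD.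
  by congr (f@_(_ - (_, _))); rewrite /= -addn1 PoszD.
apply/malgP => k; rewrite mcoeff0; apply/eqP/negP => /negP fk.
pose s := [seq k - (j%:Z, j%:Z) | j <- iota 0 (size (msupp f)).+1].
have : (size s <= size (msupp f))%N.
  apply: uniq_leq_size => [|_ /mapP[j _ ->]].
    by rewrite map_inj_uniq ?iota_uniq // => i j /addrI/oppr_inj[].
  by rewrite -mcoeff_neq0 shift.
by rewrite size_map size_iota ltnn.
Qed.

(** * The quotients of the Alexander polynomial *)

Lemma image_writhe_poly n (D : gauss_diagram n) (S : comNzRingType) (T : int -> S)
    (phi : {rmorphism laurent int -> S}) :
  (forall k, phi (t_ k) = T k) -> T 0 = 1 ->
  phi (writhe_poly D) = \sum_c (eps D c)%:~R * T (Ind D c) - (Wr D)%:~R.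
Proof.
move=> phiT T0; rewrite /writhe_poly; set s := undup _; rewrite rmorph_sum /=.
have s_uniq : uniq s := undup_uniq _.
have Ind_s c : Ind D c \in s by rewrite mem_undup in_cons codom_f orbT.
have s0 : (0 : int) \in s by rewrite mem_undup mem_head.
transitivity (\sum_(m <- s) (\sum_c (if Ind D c == m then (eps D c)%:~R * T m else 0)
   - (if m == 0 then (Wr D)%:~R * T m else 0))).
  apply: eq_bigr => m _; rewrite rmorphM /= rmorph_int phiT /writhe_coef.
  rewrite intrB mulrBl rmorph_sum /= mulr_suml big_mkcond /=.
  by congr (_ - _); case: ifP => // _; rewrite mul0r.
have pick (m0 : int) (F : int -> S) : m0 \in s ->
    \sum_(m <- s) (if m == m0 then F m else 0) = F m0.
  move=> s_m0; rewrite (bigD1_seq m0) //= eqxx big1 ?addr0 // => m.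
  by move/negPf->.
rewrite sumrB exchange_big /= (pick _ (fun m => (Wr D)%:~R * T m)) // T0 mulr1.
congr (_ - _); apply: eq_bigr => c _.
under eq_bigr => m _ do rewrite eq_sym.
exact: (pick _ (fun m => (eps D c)%:~R * T m)).
Qed.

Section Quotients.
Variables (R : comNzRingType) (h d w f p : R).

Lemma quotient_exists : d = - (h * w) + h ^+ 2 * p ->
  d = h * (- w + h * p) /\ (- w + h * p) + w = h * p.
Proof. by move=> ->; split; ring. Qed.

Lemma quotient_twice d' : d = - (h * w) + h ^+ 2 * p ->
  d = h * d' -> d' + w = h * f -> h * (h * f) = h * (h * p).
Proof.
by move=> dE dE' <-; rewrite mulrDr -dE' dE; ring.
Qed.

Lemma eqmod_cube_quotient W U : eqmod_cube h d (h * (W - U) + h ^+ 2 * p) ->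
  exists r, d = - (h * (U - W)) + h ^+ 2 * (p + h * r).
Proof. by move=> [r ->]; exists r; ring. Qed.

End Quotients.

Lemma second_coef_no_chord (D : gauss_diagram 0) (R : comNzRingType) (U : int -> int -> R) h :
  - (h * (\sum_c (eps D c)%:~R * U (Ind D c) 0 - (Wr D)%:~R)) + h ^+ 2 * second_coef D U = 0.
Proof. by rewrite /second_coef /Wr !big_ord0 subr0 !addr0 !mulr0 oppr0 addr0. Qed.

(** The coefficient of h in the expansion is the opposite of the writhe polynomial,
and the remainder of order h^3 is absorbed into [Phi], where it is killed by
the specialization. *)
Lemma Delta0_second_order n (D : gauss_diagram n) :
  exists2 Phi, Delta0 D = - (h_ * in_u (writhe_poly D)) + h_ ^+ 2 * Phi &
    eval_t_tinv Phi = V_poly D.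
Proof.
have uvD : forall k l k' l', uv_ (k + k') (l + l') = uv_ k l * uv_ k' l' := uv_D.
have WE := image_writhe_poly D (phi := in_u) in_u_t erefl.
have VE := phi_second_coef D (phi := eval_t_tinv) erefl uvD eval_uv erefl.
rewrite -/(V_poly D) in VE.
have [n0|n_gt0] := posnP n.
  subst n; exists (second_coef D uv_); last exact: VE.
  by rewrite WE (second_coef_no_chord D uv_).
have := alexander_det_eqmod_cube D erefl uvD n_gt0.
rewrite /alexander_det -Delta0_fdet // => /eqmod_cube_quotient[r ->].
exists (second_coef D uv_ + h_ * r); first by rewrite WE.
by rewrite rmorphD rmorphM /= eval_h mul0r addr0.
Qed.

Theorem theorem2 (n : nat) (D : gauss_diagram n) :
  (exists Delta0' Phi : laurent2,
      Delta0 D = (1 - uv_ 1 1) * Delta0' /\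
      Delta0' + in_u (writhe_poly D) = (1 - uv_ 1 1) * Phi) /\
  (forall Delta0' Phi : laurent2,
      Delta0 D = (1 - uv_ 1 1) * Delta0' ->
      Delta0' + in_u (writhe_poly D) = (1 - uv_ 1 1) * Phi ->
      V_poly D = eval_t_tinv Phi).
Proof.
have [Phi DE <-] := Delta0_second_order D; split.
  exists (- in_u (writhe_poly D) + h_ * Phi), Phi; exact: quotient_exists DE.
move=> d' f dE fE; congr (eval_t_tinv _).
by have /one_sub_uv_regular/one_sub_uv_regular := quotient_twice DE dE fE.
Qed.
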